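(* Let $0<a<1$ and $f\in H^2(\mathbb{D})$. If for some integer $n\geq 1$ the derivative $f^{(n)}$ is $\mathbf{EB}$, then $f$ is not a hypercyclic vector for $C_{\phi_a}$.
   Context: $H^2=H^2(\mathbb{D})$ is the Hardy-Hilbert space of holomorphic functions on the open unit disk $\mathbb{D}$. For $a\in(0,1)$, $\phi_a(z)=az+1-a$, a holomorphic self-map of $\mathbb{D}$, and $C_{\phi_a}f=f\circ\phi_a$ is the (bounded) composition operator on $H^2$. A vector $f\in H^2$ is hypercyclic for $C_{\phi_a}$ if its orbit $\{C_{\phi_a}^kf:k\ge 0\}$ is dense in $H^2$. For $n\in\mathbb{N}$ let $D_n:=\phi_{a^n}(\mathbb{D})=a^n\mathbb{D}+1-a^n$, the disk with center $1-a^n$ and radius $a^n$. A holomorphic function on $\mathbb{D}$ is called eventually bounded at $1$ ($\mathbf{EB}$) if it is bounded on $D_n$ for some $n\in\mathbb{N}$. *)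

(* Defs.v *)
(* MathComp-Analysis, over an arbitrary R : realType, with complex numbers
   R[i] from mathcomp-real-closed. *)
From HB Require Import structures.
From mathcomp Require Import all_boot all_order all_algebra.
From mathcomp Require Import complex.
From mathcomp Require Import all_classical all_reals all_analysis.
Set Implicit Arguments.
Unset Strict Implicit.
Unset Printing Implicit Defensive.
Import Order.TTheory GRing.Theory Num.Theory.
Import numFieldNormedType.Exports.
Local Open Scope classical_set_scope.
Local Open Scope ring_scope.
Local Open Scope complex_scope.

(* R[i], bundled as a numClosedFieldType: this is what equips it with the
   topology of its norm and with a normed module structure over itself, so that
   [derivable] and [derive1n] below are complex differentiability and iterated
   complex derivatives. *)
Definition Cx (R : realType) : numClosedFieldType := R[i].

Section HardySpace.
Variable R : realType.
Local Notation C := (Cx R).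
Implicit Types (f g : C -> C) (a : R).

Definition unit_disk : set C := [set z | `|z| < 1].

(* A function on the disk is represented by a total function C -> C; its values
   off the disk are arbitrary and no definition below depends on them. *)
Definition holomorphic_on_disk f := forall z, unit_disk z -> derivable f z 1.

Definition taylor_coef f (k : nat) : C := derive1n k f 0 / k`!%:R.

(* Square root of the sum of |taylor_coef f k|^2, possibly +oo; [normc] is the
   R-valued modulus. *)
Definition hardy_norm f : \bar R :=
  sqrte (\sum_(0 <= k <oo) (Normc.normc (taylor_coef f k) ^+ 2)%:E)%E.

(* The Hardy-Hilbert space H^2: holomorphic functions on the disk given there by
   a power series with square-summable coefficients. By Cauchy's theorem, which
   the libraries do not have, the second clause follows from the first. *)
Definition hardy f : Prop :=
  [/\ holomorphic_on_disk f,
      forall z, unit_disk z ->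
        series (fun k => taylor_coef f k * z ^+ k) @ \oo --> f z
    & (hardy_norm f < +oo)%E].

Definition hardy_dense (S : set (C -> C)) : Prop :=
  forall g, hardy g -> forall e : R, 0 < e ->
    exists2 h, S h & (hardy_norm (h \- g)%R < e%:E)%E.

Definition phi a (z : C) : C := a%:C * z + (1 - a%:C).

Definition comp_op (u : C -> C) f : C -> C := f \o u.

Definition op_orbit (T : (C -> C) -> (C -> C)) f : set (C -> C) :=
  [set iter k T f | k in [set: nat]].

Definition hypercyclic (T : (C -> C) -> (C -> C)) f : Prop :=
  hardy f /\ hardy_dense (op_orbit T f).

Definition disk_at1 a (m : nat) : set C := phi (a ^+ m) @` unit_disk.

Definition eventually_bounded a g : Prop :=
  exists m : nat, [bounded g z | z in disk_at1 a m].

End HardySpace.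

(* Main.v *)
Require Import Defs.
From HB Require Import structures.
From mathcomp Require Import all_boot all_order all_algebra.
From mathcomp Require Import complex.
From mathcomp Require Import ring lra.
From mathcomp Require Import all_classical all_reals all_analysis.
Import Order.TTheory GRing.Theory Num.Theory.
Import numFieldNormedType.Exports.
Local Open Scope classical_set_scope.
Local Open Scope ring_scope.

(** Why it is true.  The map sending a function to its [n]-th Taylor coefficient
at 0 is bounded by the norm of H^2 ([normc_taylor_coef_le]) and takes every
complex value on H^2 (on the multiples of z^n), so no set on which it is bounded
can be dense ([bounded_taylor_coef_not_dense]).  It is bounded on the orbit of
[f]: the [k]-th iterate is [f] composed with the affine map of slope a^k fixing
1 ([iter_comp_phi]), so by the chain rule its [n]-th derivative at 0 is
a^(kn) f^(n)(1 - a^k) ([derive1n_comp_phi]).  The points 1 - a^k with k >= m all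
lie in D_m, so if f^(n) is bounded on D_m then these numbers are bounded for
k >= m, and only finitely many indices remain
([orbit_taylor_coef_bounded]).

The iterated derivative of a difference or of a composite is the expected one
only where all the lower derivatives exist, so the argument needs functions of
H^2 to be infinitely differentiable on the disk ([hardy_smooth]).  This is
proved from their power series: if its coefficients are absolutely
summable against r^k for every r < 1, a series can be differentiated term by
term, and the differentiated series has the same property ([is_derive_power_sum],
[abs_summable_deriv_coef]), so one can iterate. *)

(** * Derivatives over a field with a norm *)

Section Derivatives.
Set Implicit Arguments.
Unset Strict Implicit.
Variable K : numFieldType.

Lemma is_derive_comp_affine (b c : K) (F : K -> K) (z : K) :
  derivable F (b * z + c) 1 ->
  is_derive z 1 (fun w => F (b * w + c)) (b * F^`()%classic (b * z + c)).
Proof.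
move=> dF; set A := fun w : K => b * w + c.
have [dA A1] : is_derive z 1 A b.
  have := is_deriveD (is_deriveZ b (is_derive_id z (1 : K))) (is_derive_cst c z (1 : K)).
  by move/is_derive_eq; apply; rewrite addr0 [LHS]mulr1.
have diffF : differentiable F (A z) by apply/derivable1_diffP.
have diffA : differentiable A z by apply/derivable1_diffP.
have diffFA : differentiable (F \o A) z by exact: differentiable_comp.
rewrite -[X in is_derive _ _ X _]/(F \o A).
apply: DeriveDef; first exact/derivable1_diffP.
by rewrite deriveE // diff_comp //= -(deriveE _ diffA) A1 deriv1E.
Qed.

Lemma derive1n_monomial (c : K) n k :
  derive1n k (fun z : K => c * z ^+ n) = (fun z => c * (z ^+ (n - k) *+ n ^_ k)).
Proof.
elim: k => [|k ih]; first by rewrite subn0.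
apply/funext => z; rewrite derive1nS ih derive1E.
have -> : (fun z : K => c * (z ^+ (n - k) *+ n ^_ k)) =
    (c * (n ^_ k)%:R) *: (@GRing.exp K ^~ (n - k)%N).
  apply/funext => w; rewrite -mulr_natr.
  (* scaling in K, as a module over itself, is multiplication *)
  change (c * (w ^+ (n - k) * (n ^_ k)%:R) = c * (n ^_ k)%:R * w ^+ (n - k)).
  by rewrite mulrA mulrAC.
rewrite deriveZ; last exact: exprn_derivable.
rewrite exp_derive -subnS.
have -> : z ^+ (n - k.+1) *+ n ^_ k.+1 =
    z ^+ (n - k.+1) * ((n ^_ k)%:R * (n - k)%:R).
  by rewrite -natrM -ffactnSr mulr_natr.
change (c * (n ^_ k)%:R * ((n - k)%:R * z ^+ (n - k.+1) * 1) =
  c * (z ^+ (n - k.+1) * ((n ^_ k)%:R * (n - k)%:R))).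
by rewrite mulr1 -mulrA; congr (_ * _); rewrite mulrA mulrC.
Qed.

End Derivatives.

(** * Limits and absolutely convergent series in the complex numbers *)

Section ComplexLimits.
Set Implicit Arguments.
Unset Strict Implicit.
Import Normc.
Local Open Scope complex_scope.
Variable R : realType.
Local Notation C := (Cx R).

Lemma normE_normc (z : C) : `|z| = (normc z)%:C.
Proof. by []. Qed.

Lemma normc_ge0 (z : C) : 0 <= normc z.
Proof. by have := normr_ge0 z; rewrite normE_normc lecR. Qed.

Lemma normcX (z : C) k : normc (z ^+ k) = normc z ^+ k.
Proof. by elim: k => [|k ih]; rewrite ?normc1 // !exprS normcM ih. Qed.

Lemma normc_real (x : R) : 0 <= x -> normc x%:C = x.
Proof. by move=> x0; rewrite /normc /= expr0n /= addr0 sqrtr_sqr ger0_norm. Qed.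

Lemma normc_sum (u : nat -> C) N :
  normc (\sum_(0 <= k < N) u k) <= \sum_(0 <= k < N) normc (u k).
Proof.
elim: N => [|N ih]; first by rewrite !big_nil normc0.
rewrite !big_nat_recr //=; apply: le_trans (le_normcD _ _) _.
by rewrite lerD2r.
Qed.

Lemma unit_disk_normc (z : C) : unit_disk z <-> normc z < 1.
Proof.
rewrite /unit_disk /= normE_normc.
by have -> : ((normc z)%:C < 1 :> C) = (normc z < 1) by exact: ltcR.
Qed.

(** In R[i] a positive tolerance is automatically real, so convergence can be
tested with the real-valued modulus, which lives in a total order. *)
Lemma cvg_normcP {T : Type} {F : set_system T} {FF : Filter F} (u : T -> C) (l : C) :
  u @ F --> l <->
  forall r : R, 0 < r -> \forall t \near F, normc (l - u t) < r.
Proof.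
rewrite (@cvgrPdist_lt _ C); split=> H.
  move=> r r0; have := H r%:C; rewrite ltcR => /(_ r0).
  by apply: filterS => t; rewrite normE_normc ltcR.
move=> e e0; have /complex_realP [r er] : e \is Num.real by rewrite ger0_real // ltW.
move: e0; rewrite er ltcR => /H; apply: filterS => t.
by rewrite normE_normc ltcR.
Qed.

Lemma normc_le_lim (u : nat -> C) (l : C) (B : R) :
  u @ \oo --> l -> (forall n, normc (u n) <= B) -> normc l <= B.
Proof.
move=> /cvg_normcP ul uB; apply/ler_addgt0Pl => e e0.
have [N _ /(_ N (leqnn N)) /= hN] := ul e e0.
have -> : l = (l - u N) + u N by rewrite addrNK.
by apply: le_trans (le_normcD _ _) _; rewrite lerD // ltW.
Qed.

Lemma abs_Re_le (z : C) : `|complex.Re z| <= normc z.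
Proof. by have := normc_ge_Re z; rewrite normE_normc lecR. Qed.

Lemma abs_Im_le (z : C) : `|complex.Im z| <= normc z.
Proof.
case: z => x y /=; rewrite -sqrtr_sqr ler_wsqrtr // lerDr sqr_ge0 //.
Qed.

Lemma normc_le_ReIm (z : C) : normc z <= `|complex.Re z| + `|complex.Im z|.
Proof.
case: z => x y /=; rewrite -[leRHS]ger0_norm ?addr_ge0 // -sqrtr_sqr.
rewrite ler_wsqrtr // sqrrD !real_normK ?num_real //.
by rewrite addrAC lerDl mulrn_wge0 // mulr_ge0.
Qed.

Lemma cvg_series_bounded (v : nat -> R) (B : R) :
  (forall N, \sum_(0 <= k < N) `|v k| <= B) -> cvgn (series v).
Proof.
move=> vB; apply: normed_cvg; apply: nondecreasing_is_cvgn.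
  by apply: nondecreasing_series => *; exact: normr_ge0.
by exists B => _ [N _ <-]; exact: vB.
Qed.

(** Absolute convergence implies convergence, by completeness of the reals applied
to the real and imaginary parts. *)
Lemma cvg_series_normc (u : nat -> C) (B : R) :
  (forall N, \sum_(0 <= k < N) normc (u k) <= B) ->
  exists l : C, series u @ \oo --> l.
Proof.
move=> uB.
have /cvg_ex[x /= cx] : cvgn (series (fun k => complex.Re (u k))).
  apply: (@cvg_series_bounded _ B) => N; apply: le_trans (uB N).
  by apply: ler_sum => k _; exact: abs_Re_le.
have /cvg_ex[y /= cy] : cvgn (series (fun k => complex.Im (u k))).
  apply: (@cvg_series_bounded _ B) => N; apply: le_trans (uB N).
  by apply: ler_sum => k _; exact: abs_Im_le.
have serE N : series u N =
    series (fun k => complex.Re (u k)) N +i* series (fun k => complex.Im (u k)) N.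
  elim: N => [|N ih]; first by rewrite !seriesEnat /= !big_nil.
  rewrite !seriesSr ih; case: (u N) => p q; simpc => //=.
exists (x +i* y); apply/cvg_normcP => r r0.
have r2 : 0 < r / 2 by rewrite divr_gt0.
move/cvgrPdist_lt: cx => /(_ _ r2) cx; move/cvgrPdist_lt: cy => /(_ _ r2) cy.
near=> N; apply: le_lt_trans (normc_le_ReIm _) _.
rewrite [ltRHS]splitr serE; simpc => /=.
by apply: ltrD; near: N.
Unshelve. all: by end_near. Qed.

End ComplexLimits.

(** * Term-by-term differentiation of power series *)

Section PowerSeries.
Set Implicit Arguments.
Unset Strict Implicit.
Import Normc.
Local Open Scope complex_scope.
Variable R : realType.
Local Notation C := (Cx R).
Implicit Types (c : nat -> C) (F : C -> C).

(** Radius of convergence at least 1, in a form that makes no reference to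
convergence. *)
Definition abs_summable_on_disk c :=
  forall r : R, 0 <= r < 1 ->
    exists B : R, forall N, \sum_(0 <= k < N) normc (c k) * r ^+ k <= B.

Definition deriv_coef c : nat -> C := fun k => c k.+1 *+ k.+1.

Definition power_sum c F :=
  forall z, unit_disk z -> series (fun k => c k * z ^+ k) @ \oo --> F z.

(** Trading the factor k + 1 produced by differentiation for a slightly larger
radius: (k + 1) r^k is at most s^(k + 1) / (s - r) when r < s. *)
Lemma mean_value_expr (r s : R) k : 0 <= r -> r <= s ->
  (s - r) * (r ^+ k *+ k.+1) <= s ^+ k.+1 - r ^+ k.+1.
Proof.
move=> r0 rs; elim: k => [|k ih]; first by rewrite expr0 !expr1 mulr1.
have -> : s ^+ k.+2 - r ^+ k.+2
    = s * (s ^+ k.+1 - r ^+ k.+1) + (s - r) * r ^+ k.+1 by rewrite !exprS; ring.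
rewrite mulrS mulrDr addrC lerD2r [in leLHS]exprS -mulrnAr mulrCA.
apply: (@le_trans _ _ (s * ((s - r) * (r ^+ k *+ k.+1)))).
  by rewrite ler_wpM2r // mulr_ge0 ?subr_ge0 // mulrn_wge0 ?exprn_ge0.
by rewrite ler_wpM2l //; exact: le_trans rs.
Qed.

(** The radius of convergence survives differentiation: to bound the new series
at [r], compare it with the old one halfway between [r] and 1. *)
Lemma abs_summable_deriv_coef c :
  abs_summable_on_disk c -> abs_summable_on_disk (deriv_coef c).
Proof.
move=> cs r /andP[r0 r1]; pose s := (r + 1) / 2.
have [rs s1] : r < s /\ s < 1 by rewrite /s; split; lra.
have s0 : 0 <= s by apply: le_trans (ltW rs).
have [|B cB] := cs s; first by rewrite s0.
have sr0 : 0 < s - r by rewrite subr_gt0.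
exists (B / (s - r)) => N; rewrite ler_pdivlMr // mulr_suml.
apply: le_trans (cB N.+1); rewrite [leRHS]big_nat_recl //=.
apply: (@le_trans _ _ (\sum_(0 <= i < N) normc (c i.+1) * s ^+ i.+1)); last first.
  by rewrite lerDr mulr_ge0 ?normc_ge0 ?exprn_ge0.
apply: ler_sum => k _; rewrite /deriv_coef normcMn mulrnAl -mulrnAr -mulrA.
rewrite ler_wpM2l ?normc_ge0 // mulrC.
apply: le_trans (mean_value_expr k r0 (ltW rs)) _.
by rewrite gerBl exprn_ge0.
Qed.

Lemma power_series_cvg c (z : C) : abs_summable_on_disk c -> unit_disk z ->
  exists l : C, series (fun k => c k * z ^+ k) @ \oo --> l.
Proof.
move=> cs /unit_disk_normc z1.
have [|B cB] := cs (normc z); first by rewrite normc_ge0.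
apply: (@cvg_series_normc _ _ B) => N; apply: le_trans (cB N).
by apply: ler_sum => k _; rewrite normcM normcX.
Qed.

(** Second-order Taylor bound for a monomial, with [rho] bounding both points.
Writing E_k for the remainder, E_(k+1) = (h + z) E_k + k h^2 z^(k-1), and
|h|^2 k (k - 1) rho^(k-2) dominates this recursion. *)
Lemma normc_taylor2_expr (z h : C) (rho : R) k :
  normc z <= rho -> normc (h + z) <= rho ->
  normc ((h + z) ^+ k - z ^+ k - h * (z ^+ k.-1 *+ k))
    <= normc h ^+ 2 * (rho ^+ k.-2 *+ (k * k.-1)).
Proof.
move=> zr hzr; have rho0 : 0 <= rho by apply: le_trans zr; exact: normc_ge0.
case: k => [|k].
  by rewrite !expr0 subrr sub0r !mulr0n mulr0 oppr0 normc0 mulr0.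
elim: k => [|k ih].
  by rewrite !expr1 mulr1n /= muln0 mulr0n mulr0 expr0 mulr1 addrK subrr normc0.
have -> : (h + z) ^+ k.+2 - z ^+ k.+2 - h * (z ^+ k.+1 *+ k.+2) =
    (h + z) * ((h + z) ^+ k.+1 - z ^+ k.+1 - h * (z ^+ k *+ k.+1))
    + h ^+ 2 * (z ^+ k *+ k.+1).
  rewrite -(mulr_natr (z ^+ k.+1)) -(mulr_natr (z ^+ k)) -(natr1 k.+1) !exprS.
  by rewrite expr0; ring.
apply: le_trans (le_normcD _ _) _; rewrite !normcM normcMn !normcX.
(* the dominating recursion has room for one more copy of the last term *)
have -> : normc h ^+ 2 * (rho ^+ k.+2.-2 *+ (k.+2 * k.+2.-1)) =
    rho * (normc h ^+ 2 * (rho ^+ k.-1 *+ (k.+1 * k)))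
    + normc h ^+ 2 * (rho ^+ k *+ k.+1) + normc h ^+ 2 * (rho ^+ k *+ k.+1).
  case: k {ih} => [|k] /=; first by rewrite !mulr0n; ring.
  rewrite -!(mulr_natr (rho ^+ _)) !natrM !exprS -!natr1; ring.
apply: (@le_trans _ _ (rho * (normc h ^+ 2 * (rho ^+ k.-1 *+ (k.+1 * k)))
   + normc h ^+ 2 * (rho ^+ k *+ k.+1))); last first.
  by rewrite lerDl mulr_ge0 ?exprn_ge0 ?normc_ge0 // mulrn_wge0 // exprn_ge0.
apply: lerD; first by rewrite ler_pM ?normc_ge0.
rewrite -expr2 ler_wpM2l ?exprn_ge0 ?normc_ge0 // lerMn2r /= lerXn2r //.
all: by rewrite nnegrE ?normc_ge0.
Qed.

(** Summing the bound for monomials: the constant [K] is a bound for the series of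
moduli of the twice differentiated series at [rho].  Partial sums are compared
and the limit is taken afterwards. *)
Lemma normc_power_sum_taylor2 c F (z : C) (l : C) (rho K : R) :
  power_sum c F -> rho < 1 ->
  (forall N, \sum_(0 <= k < N) normc (deriv_coef (deriv_coef c) k) * rho ^+ k <= K) ->
  series (fun k => deriv_coef c k * z ^+ k) @ \oo --> l ->
  forall h : C, normc z <= rho -> normc (h + z) <= rho ->
  normc (F (h + z) - F z - h * l) <= normc h ^+ 2 * K.
Proof.
move=> cF rho1 cK cl h zr hzr.
have shiftN (u : nat -> C) (v : C) n : u @ \oo --> v -> u (N + n)%N @[N --> \oo] --> v.
  by move=> uv; apply: (cvg_comp _ _ (cvg_addnr n) uv).
have Fhz : series (fun k => c k * (h + z) ^+ k) @ \oo --> F (h + z).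
  by apply/cF/unit_disk_normc/(le_lt_trans hzr).
have Fz : series (fun k => c k * z ^+ k) @ \oo --> F z.
  by apply/cF/unit_disk_normc/(le_lt_trans zr).
have T : (fun N => series (fun k => c k * (h + z) ^+ k) (N + 2)%N
       - series (fun k => c k * z ^+ k) (N + 2)%N
       - h * series (fun k => deriv_coef c k * z ^+ k) (N + 1)%N) @ \oo -->
   F (h + z) - F z - h * l.
  have A1 := shiftN _ _ 2%N Fhz; have A2 := shiftN _ _ 2%N Fz.
  have A3 := shiftN _ _ 1%N cl.
  exact: (@cvgB C C _ _ _ _ _ _ _ (@cvgB C C _ _ _ _ _ _ _ A1 A2)
           (@cvgMl_tmp C _ _ _ _ h _ A3)).
apply: (normc_le_lim T) => N.
have -> : series (fun k => deriv_coef c k * z ^+ k) (N + 1)%N =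
    \sum_(0 <= k < N.+2) c k * (z ^+ k.-1 *+ k).
  rewrite addn1 seriesEnat /= [RHS]big_nat_recl //= mulr0n mulr0 add0r.
  by apply: eq_bigr => k _; rewrite /deriv_coef mulrnAl mulrnAr.
rewrite addn2 !seriesEnat /= mulr_sumr -!sumrB.
apply: le_trans (normc_sum _ _) _.
apply: le_trans (ler_wpM2l (exprn_ge0 2 (normc_ge0 h)) (cK N)).
rewrite mulr_sumr big_nat_recl // big_nat_recl //.
(* the terms of index 0 and 1 have no remainder *)
set x := (X in normc X + _); have -> : x = 0.
  by rewrite /x !expr0 mulr0n !mulr0 subrr subr0.
set y := (X in _ + (normc X + _)); have -> : y = 0.
  by rewrite /y !expr1 expr0 mulr1n; ring.
rewrite !normc0 !add0r; apply: ler_sum => k _.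
have -> : c k.+2 * (h + z) ^+ k.+2 - c k.+2 * z ^+ k.+2
    - h * (c k.+2 * (z ^+ k.+1 *+ k.+2))
    = c k.+2 * ((h + z) ^+ k.+2 - z ^+ k.+2 - h * (z ^+ k.+2.-1 *+ k.+2)).
  rewrite [in RHS]mulrBr mulrBr; congr (_ - _); exact: mulrCA.
rewrite normcM /deriv_coef -mulrnA normcMn mulrnAl -mulrnAr mulrCA.
by rewrite ler_wpM2l ?normc_ge0 //; exact: normc_taylor2_expr.
Qed.

(** The remainder of order two, divided by the increment, tends to 0. *)
Lemma is_derive_power_sum c F (z : C) (l : C) :
  abs_summable_on_disk c -> power_sum c F -> unit_disk z ->
  series (fun k => deriv_coef c k * z ^+ k) @ \oo --> l ->
  is_derive z 1 F l.
Proof.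
move=> cs cF /unit_disk_normc z1 cl.
pose rho := (normc z + 1) / 2; have z0 := normc_ge0 z.
have [zrho rho1] : normc z < rho /\ rho < 1 by rewrite /rho; split; lra.
have [|K cK] := abs_summable_deriv_coef (abs_summable_deriv_coef cs) (r := rho).
  by apply/andP; split; lra.
have taylor := normc_power_sum_taylor2 cF rho1 cK cl.
have K0 : 0 <= K by have := cK 0%N; rewrite big_nil.
have dq : h^-1 *: ((F \o shift z) (h *: (1 : C)) - F z) @[h --> (0 : C)^'] --> l.
  apply/cvg_normcP => e e0.
  (* the first bound keeps h + z within radius rho, the second makes |h| K < e *)
  pose d := Num.min (rho - normc z) (e / (K + 1)).
  have d0 : 0 < d by rewrite lt_min subr_gt0 zrho divr_gt0 // ltr_wpDl.
  near=> h.
  have hd : normc h < d.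
    have : `|h| < d%:C by near: h; apply: dnbhs0_lt; rewrite ltcR.
    by rewrite normE_normc ltcR.
  have h0 : h != 0 by near: h; exact: nbhs_dnbhs_neq.
  have nh0 : 0 < normc h.
    rewrite lt_neqAle normc_ge0 andbT eq_sym; apply: contra h0 => /eqP.
    by move/eq0_normc => ->.
  move: hd; rewrite lt_min => /andP[hd1 hd2].
  have hzrho : normc (h + z) <= rho.
    by apply: le_trans (le_normcD _ _) _; rewrite -lerBrDr ltW.
  rewrite /= scaler1 -normcN opprB.
  have -> : h^-1 *: (F (h + z) - F z) - l = h^-1 * (F (h + z) - F z - h * l).
    by rewrite mulrBr mulKf.
  rewrite normcM normcV mulrC ltr_pdivrMr //.
  apply: le_lt_trans (taylor h (ltW zrho) hzrho) _.
  rewrite expr2 -mulrA mulrC ltr_pM2r //.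
  rewrite ltr_pdivlMr ?ltr_wpDl // in hd2.
  apply: le_lt_trans hd2; rewrite ler_wpM2l ?normc_ge0 // lerDl //.
apply: DeriveDef; first by apply/cvg_ex; exists l.
exact: (cvg_lim _ dq).
Unshelve. all: by end_near. Qed.

End PowerSeries.

(** * Functions with all derivatives on the disk *)

Section SmoothOnDisk.
Set Implicit Arguments.
Unset Strict Implicit.
Import Normc.
Local Open Scope complex_scope.
Variable R : realType.
Local Notation C := (Cx R).
Implicit Types (f g F : C -> C).

(** [derive1n] is total, so its value at an order means something only if the
derivatives of lower order are themselves derivable. *)
Definition smooth_on_disk f :=
  forall n z, unit_disk z -> derivable (derive1n n f) z 1.

Lemma unit_disk0 : unit_disk (0 : C).
Proof. by rewrite /unit_disk /= normr0. Qed.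

Lemma near_unit_disk (z : C) : unit_disk z -> \forall w \near z, unit_disk w.
Proof.
move=> /unit_disk_normc z1; have /cvg_normcP : id w @[w --> z] --> z by exact: cvg_id.
move=> /(_ (1 - normc z)); rewrite subr_gt0 => /(_ z1).
apply: filterS => w zw; apply/unit_disk_normc.
have -> : w = z + - (z - w) by rewrite opprB addrCA subrr addr0.
apply: le_lt_trans (le_normcD _ _) _; rewrite normcN.
by rewrite addrC -ltrBrDr.
Qed.

(** Each derivative is again the sum of a power series of the same kind. *)
Lemma power_sum_smooth (c : nat -> C) F :
  abs_summable_on_disk c -> power_sum c F -> smooth_on_disk F.
Proof.
move=> cs cF n.
have : exists c' : nat -> C, abs_summable_on_disk c' /\ power_sum c' (derive1n n F).
  elim: n => [|n [c' [cs' cF']]]; first by exists c.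
  exists (deriv_coef c'); split; first exact: abs_summable_deriv_coef.
  move=> z z1.
  have [l cl] := power_series_cvg (abs_summable_deriv_coef cs') z1.
  have [_ dl] := is_derive_power_sum cs' cF' z1 cl.
  by rewrite derive1nS derive1E dl.
move=> [c' [cs' cF']] z z1.
have [l cl] := power_series_cvg (abs_summable_deriv_coef cs') z1.
by have [] := is_derive_power_sum cs' cF' z1 cl.
Qed.

Lemma derive1nB f g n z : smooth_on_disk f -> smooth_on_disk g -> unit_disk z ->
  derive1n n (f \- g) z = derive1n n f z - derive1n n g z.
Proof.
move=> sf sg; elim: n z => [//|n ih] z z1.
rewrite !derive1nS !derive1E -deriveB; [|exact: sf|exact: sg].
apply: near_eq_derive; have := near_unit_disk z1.
by apply: filterS => w w1; rewrite ih.
Qed.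

Lemma phi_disk (b : R) (z : C) : 0 < b -> b <= 1 -> unit_disk z -> unit_disk (phi b z).
Proof.
move=> b0 b1 /unit_disk_normc z1; apply/unit_disk_normc.
rewrite /phi; apply: le_lt_trans (le_normcD _ _) _.
have -> : 1 - b%:C = (1 - b)%:C :> C by rewrite rmorphB.
rewrite normcM !normc_real ?subr_ge0 // ?ltW //.
by rewrite addrA [_ + 1]addrC -addrA gtrDl subr_lt0 gtr_pMr.
Qed.

Lemma phiM (b c : R) (z : C) : phi b (phi c z) = phi (b * c) z.
Proof.
rewrite /phi rmorphM /= mulrDr mulrA -addrA; congr (_ + _).
by rewrite mulrBr mulr1 addrC addrA subrK.
Qed.

Lemma iter_comp_phi (a : R) f k :
  iter k (comp_op (phi a)) f = f \o phi (a ^+ k).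
Proof.
elim: k => [|k ih].
  apply/funext => z /=; rewrite /phi expr0 mul1r subrr addr0 //.
by rewrite iterS ih; apply/funext => z; rewrite /comp_op /= phiM exprSr.
Qed.

Lemma derive1n_comp_phi (b : R) f n (z : C) : 0 < b -> b <= 1 ->
  smooth_on_disk f -> unit_disk z ->
  derive1n n (f \o phi b) z = (b ^+ n)%:C * derive1n n f (phi b z)
  /\ derivable (derive1n n (f \o phi b)) z 1.
Proof.
move=> b0 b1 sf z1.
have dz w m : unit_disk w -> is_derive w 1
    (fun w => ((b ^+ m)%:C : C) * derive1n m f (phi b w))
    (((b ^+ m.+1)%:C : C) * derive1n m.+1 f (phi b w)).
  move=> w1; have dm := is_derive_comp_affine (sf m _ (phi_disk b0 b1 w1)).
  have := is_deriveZ (b ^+ m)%:C dm => /is_derive_eq; apply.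
  by rewrite derive1nS exprSr rmorphM -mulrA.
suff E m w : unit_disk w ->
    derive1n m (f \o phi b) w = (b ^+ m)%:C * derive1n m f (phi b w).
  split; first exact: E.
  have [dd _] := dz z n z1; apply: near_eq_derivable dd.
  have := near_unit_disk z1.
  by apply: filterS => w w1; rewrite E.
elim: m w => [|m ih] w w1; first by rewrite expr0 mul1r.
rewrite derive1nS derive1E -(@derive_val _ _ _ _ _ _ _ (dz w m w1)).
apply: near_eq_derive; have := near_unit_disk w1.
by apply: filterS => v v1; rewrite ih.
Qed.

End SmoothOnDisk.

(** * Taylor coefficients on the Hardy space *)

Section HardyCoefficients.
Set Implicit Arguments.
Unset Strict Implicit.
Import Normc.
Local Open Scope complex_scope.
Variable R : realType.
Local Notation C := (Cx R).
Implicit Types (f g : C -> C).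

(** A single term is at most the whole sum of squares. *)
Lemma normc_taylor_coef_le f n :
  ((normc (taylor_coef f n))%:E <= hardy_norm f)%E.
Proof.
have -> : (normc (taylor_coef f n))%:E = sqrte ((normc (taylor_coef f n) ^+ 2)%:E).
  by rewrite /= sqrtr_sqr ger0_norm // normc_ge0.
have ge0 k : (0 <= (normc (taylor_coef f k) ^+ 2)%:E)%E by rewrite lee_fin sqr_ge0.
rewrite /hardy_norm lee_sqrt; last exact: nneseries_ge0.
apply: le_trans (nneseries_lim_ge n.+1 _); last by [].
by rewrite big_nat_recr //= leeDr // sume_ge0.
Qed.

(** The coefficients are bounded, so their power series is dominated by a
geometric one. *)
Lemma hardy_smooth f : hardy f -> smooth_on_disk f.
Proof.
move=> [_ fsum fnorm]; apply: (@power_sum_smooth _ (taylor_coef f)) => // r /andP[r0 r1].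
have /fineK fE : hardy_norm f \is a fin_num by rewrite ge0_fin_numE ?sqrte_ge0.
have coefB k : normc (taylor_coef f k) <= fine (hardy_norm f).
  by rewrite -lee_fin fE normc_taylor_coef_le.
have S0 : 0 <= fine (hardy_norm f) by apply: le_trans (coefB 0%N); exact: normc_ge0.
exists (fine (hardy_norm f) * (1 - r)^-1) => N.
apply: (@le_trans _ _ (\sum_(0 <= k < N) fine (hardy_norm f) * r ^+ k)).
  by apply: ler_sum => k _; rewrite ler_wpM2r // exprn_ge0.
rewrite -mulr_sumr ler_wpM2l // -div1r ler_pdivlMr ?subr_gt0 //.
rewrite big_mkord mulrC -opprB mulNr -subrX1 opprB gerBl exprn_ge0 //.
Qed.

Lemma taylor_coef_monomial (c : C) n k :
  taylor_coef (fun z => c * z ^+ n) k = if k == n then c else 0.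
Proof.
rewrite /taylor_coef derive1n_monomial expr0n subn_eq0.
have [->|kn] := eqVneq k n.
  rewrite leqnn ffactnn mulr1n mulfK // pnatr_eq0 -lt0n fact_gt0 //.
have [nk|kn'] := leqP n k; last by rewrite mul0rn mulr0 mul0r.
by rewrite ffact_small ?mulr0n ?mulr0 ?mul0r // ltn_neqAle eq_sym kn nk.
Qed.

(** Only one coefficient is nonzero, so the series is eventually constant and the
norm is a finite sum. *)
Lemma hardy_monomial (c : C) n : hardy (fun z => c * z ^+ n).
Proof.
split.
- move=> z _; apply: (@derivableZ _ _ _ (@GRing.exp C ^~ n) c).
  exact: exprn_derivable.
- move=> z _; apply: cvg_near_cst; exists n.+1 => // N /= nN.
  rewrite seriesEnat /= (bigD1_seq n) ?mem_index_iota ?iota_uniq //=.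
  rewrite big1 ?addr0 ?taylor_coef_monomial ?eqxx // => k kn.
  by rewrite taylor_coef_monomial (negbTE kn) mul0r.
- rewrite /hardy_norm.
  have ge0 k : (0 <= (normc (taylor_coef (fun z : C => c * z ^+ n)%R k) ^+ 2)%:E)%E.
    by rewrite lee_fin sqr_ge0.
  have lty : (\sum_(0 <= k <oo)
      (normc (taylor_coef (fun z : C => c * z ^+ n)%R k) ^+ 2)%:E < +oo)%E.
    rewrite (@nneseries_split _ _ 0%N n.+1) // [X in (_ + X)%E]eseries0.
      by rewrite adde0 sumEFin ltry.
    move=> k nk _; rewrite taylor_coef_monomial.
    by rewrite gtn_eqF // normc0 expr0n.
  rewrite -ge0_fin_numE ?sqrte_ge0 // sqrte_fin_num ?nneseries_ge0 //.
  by rewrite ge0_fin_numE // nneseries_ge0.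
Qed.

(** For k >= m the point 1 - a^k, image of 0, lies in D_m because the maps [phi]
compose by multiplying slopes; the factors a^(kn) and 1/n! only help.  The
finitely many k < m are absorbed by adding their coefficients to the bound. *)
Lemma orbit_taylor_coef_bounded (a : R) f n : 0 < a -> a < 1 ->
  smooth_on_disk f -> eventually_bounded a (derive1n n f) ->
  exists B : R, forall k, normc (taylor_coef (f \o phi (a ^+ k)) n) <= B.
Proof.
move=> a0 a1 sf [m [M [Mreal HM]]].
have ak0 k : 0 < a ^+ k by rewrite exprn_gt0.
have ak1 k : a ^+ k <= 1 by rewrite exprn_ile1 // ltW.
have /complex_realP [M' ME] := Mreal.
pose u k := normc (taylor_coef (f \o phi (a ^+ k)) n).
have u0 k : 0 <= u k by exact: normc_ge0.
have uM k : (m <= k)%N -> u k <= `|M' + 1|.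
  move=> mk; rewrite /u /taylor_coef.
  have [-> _] := derive1n_comp_phi n (ak0 k) (ak1 k) sf (unit_disk0 R).
  rewrite normcM normcM normcV.
  have bnd : normc (derive1n n f (phi (a ^+ k) 0)) <= M' + 1.
    (* boundedness is stated for the bounds beyond M, hence the M' + 1 *)
    have /(HM (M' + 1)%:C) H : M < (M' + 1)%:C by rewrite ME ltcR ltrDl.
    have := H (phi (a ^+ k) 0); rewrite /= normE_normc lecR; apply.
    exists (phi (a ^+ (k - m)) 0); first by apply: phi_disk => //; exact: unit_disk0.
    by rewrite phiM -exprD subnKC.
  have fact1 : (normc (n`!%:R : C))^-1 <= 1.
    by rewrite normcMn normc1 invf_le1 ?ler1n ?ltr0n fact_gt0.
  have bkn : normc ((a ^+ k) ^+ n)%:C <= 1.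
    by rewrite normc_real ?exprn_ge0 ?exprn_ile1 // ltW.
  apply: le_trans (ler_norm (M' + 1)); apply: le_trans bnd.
  apply: (@le_trans _ _ (1 * normc (derive1n n f (phi (a ^+ k) 0)) * 1)); last first.
    by rewrite mul1r mulr1.
  by rewrite !ler_pM ?mulr_ge0 ?invr_ge0 ?normc_ge0.
exists (`|M' + 1| + \sum_(0 <= i < m) u i) => k.
have [mk|km] := leqP m k.
  by apply: le_trans (uM _ mk) _; rewrite lerDl sumr_ge0.
apply: (@le_trans _ _ (\sum_(0 <= i < m) u i)); last by rewrite lerDr.
rewrite (bigD1_seq k) ?mem_index_iota ?iota_uniq //= lerDl sumr_ge0 //.
Qed.

(** Density would put some member of [S] at distance less than 1 from a multiple
of z^n whose coefficient exceeds the bound by 1. *)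
Lemma bounded_taylor_coef_not_dense (S : set (C -> C)) n (B : R) :
  (forall h, S h -> smooth_on_disk h /\ normc (taylor_coef h n) <= B) ->
  ~ hardy_dense S.
Proof.
move=> SB dense; pose c : C := (`|B| + 1)%:C.
have hg := hardy_monomial c n.
have [h /SB [sh tB]] := dense _ hg 1 ltr01.
move=> /(le_lt_trans (normc_taylor_coef_le _ n)); rewrite lte_fin.
have z1 := unit_disk0 R.
rewrite /taylor_coef derive1nB ?mulrBl; [|exact: sh|exact: hardy_smooth|exact: z1].
rewrite -!/(taylor_coef _ n) taylor_coef_monomial eqxx.
set t := taylor_coef _ _ in tB *; move=> lt1.
have : normc c <= normc (t - c) + normc t.
  by have := le_normcD (c - t) t; rewrite subrK -[c - t]opprB normcN.
have := ler_norm B; rewrite normc_real ?addr_ge0 //; lra.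
Qed.

End HardyCoefficients.

Theorem proposition8 (R : realType) (a : R) (ha0 : 0 < a) (ha1 : a < 1)
  (f : Cx R -> Cx R) (hf : hardy f)
  (hEB : exists n : nat, (1 <= n)%N /\ eventually_bounded a (derive1n n f)) :
  ~ hypercyclic (comp_op (phi a)) f.
Proof.
move: hEB => [n [_ EBf]] [_]; have sf := hardy_smooth hf.
have [B orbitB] := orbit_taylor_coef_bounded ha0 ha1 sf EBf.
apply: (@bounded_taylor_coef_not_dense _ _ n B) => _ [k _ <-].
rewrite iter_comp_phi; split; last exact: orbitB.
move=> j z z1; apply: (derive1n_comp_phi j _ _ sf z1).2; first exact: exprn_gt0.
by rewrite exprn_ile1 // ltW.
Qed.
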